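(* Let $\mu\in\mathcal{M}$ not be a point mass, $q>0$, and $\alpha\in\mathbb{R}$. The following statements are equivalent: (1) the point $\alpha$ is an atom of the measure $\mu^{\uplus q}$; (2) $F_\mu(\alpha)=\alpha/q^*$ and the Julia–Carathéodory derivative $F_\mu'(\alpha)\in(1,\infty)$; (3) $F_\mu(\alpha)=\alpha/q^*$ and $f_\mu(\alpha)\in(0,\infty)$. If these hold and $r=(1-\mu^{\uplus q}(\{\alpha\}))^{-1}>1$, then the Nevanlinna representation $F_\mu(z)=\Re F_\mu(i)+z+\int_{\mathbb{R}}\frac{1+sz}{s-z}\,d\rho(s)$ holds for $z=\alpha$ and $$F_\mu'(\alpha)=1+f_\mu(\alpha)=1+\frac{1}{q(r-1)}.$$
   Context: $\mathcal{M}$ is the set of Borel probability measures on $\mathbb{R}$ and $\mathbb{C}^+$ is the open upper half-plane. For $\mu\in\mathcal{M}$: $G_\mu(z)=\int_{\mathbb{R}}\frac{d\mu(s)}{z-s}$, $F_\mu=1/G_\mu$, $E_\mu(z)=z-F_\mu(z)$ for $z\in\mathbb{C}^+$. For $q\ge0$, the Boolean power $\mu^{\uplus q}\in\mathcal{M}$ is the unique measure with $E_{\mu^{\uplus q}}=qE_\mu$. For $q>0$, $q^*$ is the conjugate exponent, $\frac1q+\frac1{q^*}=1$, with $1/q^*=0$ if $q=1$; thus $\alpha/q^*=\alpha(1-1/q)$. $F_\mu$ has the Nevanlinna representation $F_\mu(z)=\Re F_\mu(i)+z+\int_{\mathbb{R}}\frac{1+sz}{s-z}\,d\rho(s)$,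 $z\in\mathbb{C}^+$, with a unique finite positive Borel measure $\rho$ on $\mathbb{R}$, and $f_\mu(x)=\int_{\mathbb{R}}\frac{s^2+1}{(s-x)^2}\,d\rho(s)\in[0,\infty]$ for $x\in\mathbb{R}$. For $x\in\mathbb{R}$, $F_\mu(x)=c$ means that $F_\mu(z)\to c$ as $z\to x$ nontangentially ($z\in\mathbb{C}^+$, $(\Re z-x)/\Im z$ bounded). The Julia–Carathéodory derivative $F_\mu'(x)$ is the nontangential limit of $\frac{F_\mu(z)-F_\mu(x)}{z-x}$ as $z\to x$. *)

(* Defs.v *)
From HB Require Import structures.
From mathcomp Require Import all_boot all_order all_algebra.
From mathcomp Require Import complex.
From mathcomp Require Import all_classical all_reals all_analysis.

Set Implicit Arguments.
Unset Strict Implicit.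
Unset Printing Implicit Defensive.

Import Order.TTheory GRing.Theory Num.Theory numFieldNormedType.Exports.

Local Open Scope classical_set_scope.
Local Open Scope ring_scope.
Local Open Scope complex_scope.

Section complex_integral.
Context {R : realType}.
Variable m : {measure set (measurableTypeR R) -> \bar R}.

Definition cintegrable (f : R -> R[i]) : Prop :=
  m.-integrable setT (fun s => (complex.Re (f s))%:E) /\
  m.-integrable setT (fun s => (complex.Im (f s))%:E).

Definition cintegral (f : R -> R[i]) : R[i] :=
  (\int[m]_s complex.Re (f s)) +i* (\int[m]_s complex.Im (f s)).

End complex_integral.

Section nontangential.
Context {R : realType}.
Implicit Types (f : R[i] -> R[i]) (x : R) (c d : R[i]).

Definition upper_half_plane : set R[i] := [set z | 0 < complex.Im z].

Definition nt_sector x (K : R) : set R[i] :=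
  upper_half_plane `&` [set z | `|complex.Re z - x| <= K * complex.Im z].

(* The regular-module alias R[i]^o carries the norm topology of the complex
   plane; R[i] itself has no declared topology. *)
Definition nt_limit f x c : Prop :=
  forall K : R,
    f z @[z --> within (nt_sector x K) (nbhs (x%:C : R[i]^o))] --> (c : R[i]^o).

Definition JC_derivative f x d : Prop :=
  exists2 c, nt_limit f x c &
             nt_limit (fun z => (f z - c) / (z - x%:C)) x d.

End nontangential.

Section transforms.
Context {R : realType}.
Implicit Types mu nu : probability (measurableTypeR R) R.

Definition point_mass mu : Prop :=
  exists a : R, forall A : set (measurableTypeR R),
    measurable A -> mu A = \d_a A.

Definition cauchy_transform mu (z : R[i]) : R[i] :=
  cintegral mu (fun s => (z - s%:C)^-1).

Definition F_transform mu (z : R[i]) : R[i] := (cauchy_transform mu z)^-1.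

Definition E_transform mu (z : R[i]) : R[i] := z - F_transform mu z.

Definition boolean_power mu (q : R) nu : Prop :=
  forall z, upper_half_plane z -> E_transform nu z = q%:C * E_transform mu z.

End transforms.

Section nevanlinna.
Context {R : realType}.
Implicit Types (mu : probability (measurableTypeR R) R)
  (rho : {finite_measure set (measurableTypeR R) -> \bar R}).

Definition nevanlinna_kernel (z : R[i]) (s : R) : R[i] :=
  (1 + s%:C * z) / (s%:C - z).

Definition nevanlinna_formula mu rho (z : R[i]) : R[i] :=
  (complex.Re (F_transform mu (0 +i* 1)))%:C + z
  + cintegral rho (nevanlinna_kernel z).

Definition nevanlinna_measure mu rho : Prop :=
  forall z, upper_half_plane z -> F_transform mu z = nevanlinna_formula mu rho z.

(* At a real point x the kernel is infinite at s = x, where the totalized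
   division of R[i] returns 0 instead; for the integral to have its usual
   meaning there, rho must not charge x. *)
Definition nevanlinna_at mu rho (x : R) : Prop :=
  [/\ rho [set x] = 0%E,
      cintegrable rho (nevanlinna_kernel x%:C) &
      nt_limit (F_transform mu) x (nevanlinna_formula mu rho x%:C)].

(* Extended-real division: the integrand is +oo at s = x. *)
Definition nevanlinna_f rho (x : R) : \bar R :=
  (\int[rho]_s ((s ^+ 2 + 1)%:E / ((s - x) ^+ 2)%:E))%E.

End nevanlinna.

(* Main.v *)
Require Import Defs.
From HB Require Import structures.
From mathcomp Require Import all_boot all_order all_algebra.
From mathcomp Require Import complex.
From mathcomp Require Import all_classical all_reals all_analysis.
From mathcomp Require Import measurable_realfun.
From mathcomp Require Import ring lra.

Import Order.TTheory GRing.Theory Num.Theory numFieldNormedType.Exports.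

Local Open Scope classical_set_scope.
Local Open Scope ring_scope.
Local Open Scope complex_scope.

Set Implicit Arguments.
Unset Strict Implicit.
Unset Printing Implicit Defensive.

(** Everything rests on one elementary fact: for a finite measure [m],
    [(z - x) G_m(z)] tends nontangentially to [m({x})], because the integrand
    [(z - x) / (z - s)] is bounded on a sector and tends to the indicator of
    [{x}] ([nt_limit_atom]).  Written for [F = 1 / G], this says that
    [nu({x}) = 1 / t > 0] exactly when [F_nu(z) / (z - x) -> t]
    ([nt_slope_F_atom]).

    The relation [E_nu = q E_mu] is affine in [F], and it turns [F_nu(z)] into
    [q (F_mu(z) - c) + (1 - q) (z - x)] with [c = x (1 - 1/q) = x / q*].  Hence
    an atom of [nu] of mass [1 / t] at [x] is the same thing as a boundary value
    [c] of [F_mu] at [x] together with the Julia-Caratheodory derivative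
    [1 + (t - 1) / q] ([boolean_power_atomP]).  The derivative exceeds [1]
    because the mass is less than [1]: if [nu] were the Dirac mass at [x], then
    [F_mu(z)] would be [z - x / q], and [mu] would be a Dirac mass
    ([boolean_power_atom_lt1]).

    It remains to compare the derivative with [f_mu].  If [f_mu(x)] is finite,
    then [rho] does not charge [x] and the difference quotient of the Nevanlinna
    kernel, [(1 + s^2) / ((s - z) (s - x))], is dominated on every sector by a
    multiple of [(1 + s^2) / (s - x)^2]; dominated convergence gives the
    boundary value predicted by the formula and the derivative [1 + f_mu(x)]
    ([nt_slope_nevanlinna]).  Conversely, if [F_mu] has a real boundary value
    and a real derivative [d], then along [x + i y] the real part of the
    difference quotient is [1 + int (1 + s^2) / ((s - x)^2 + y^2) d rho], and
    monotone convergence as [y] decreases to [0] yields [f_mu(x) = d - 1]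
    ([nevanlinna_f_JC]). *)

(** * Complex numbers through their real and imaginary parts *)

Section complex_facts.
Context {R : realType}.
Implicit Types (z w : R[i]) (x t : R).

Lemma cReD z w : complex.Re (z + w) = complex.Re z + complex.Re w.
Proof. by case: z; case: w. Qed.
Lemma cImD z w : complex.Im (z + w) = complex.Im z + complex.Im w.
Proof. by case: z; case: w. Qed.
Lemma cReN z : complex.Re (- z) = - complex.Re z.
Proof. by case: z. Qed.
Lemma cImN z : complex.Im (- z) = - complex.Im z.
Proof. by case: z. Qed.
Lemma cReM z w : complex.Re (z * w) =
  complex.Re z * complex.Re w - complex.Im z * complex.Im w.
Proof. by case: z; case: w. Qed.
Lemma cImM z w : complex.Im (z * w) =
  complex.Re z * complex.Im w + complex.Im z * complex.Re w.
Proof. by case: z => a b; case: w => c d /=; rewrite [b * c]mulrC. Qed.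
Lemma cReV z : complex.Re z^-1 =
  complex.Re z / (complex.Re z ^+ 2 + complex.Im z ^+ 2).
Proof. by case: z. Qed.
Lemma cImV z : complex.Im z^-1 =
  - (complex.Im z / (complex.Re z ^+ 2 + complex.Im z ^+ 2)).
Proof. by case: z. Qed.

Lemma complex_eqP z w :
  complex.Re z = complex.Re w -> complex.Im z = complex.Im w -> z = w.
Proof. by case: z => a b; case: w => c d /= -> ->. Qed.

Lemma normc_real x : `|x%:C| = `|x|%:C :> R[i].
Proof. by rewrite normc_def /= expr0n addr0 sqrtr_sqr. Qed.

Lemma normc_ge_Im z : `|complex.Im z|%:C <= `|z|.
Proof.
case: z => a b; rewrite normc_def /= lecR -sqrtr_sqr ler_wsqrtr//.
by rewrite lerDr sqr_ge0.
Qed.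

Lemma normc_le_ReIm z : `|z| <= (`|complex.Re z| + `|complex.Im z|)%:C.
Proof.
case: z => a b; rewrite (_ : a +i* b = a%:C + (0 +i* b)); last first.
  by apply: complex_eqP; rewrite /= ?addr0 ?add0r.
apply: (le_trans (ler_normD _ _)); rewrite normc_real normc_def /=.
by rewrite expr0n/= !add0r addr0 sqrtr_sqr -rmorphD.
Qed.

End complex_facts.

Section complex_limits.
Context {R : realType} {T : Type} (F : set_system T) {FF : Filter F}.
Implicit Types (f : T -> R[i]) (c : R[i]).

(** A positive element of the ordered field [R[i]] is real, so only real radii
    matter in the metric of the complex plane. *)
Lemma cvgc_ltP f c : f @ F --> (c : R[i]^o) <->
  forall e : R, 0 < e -> \forall t \near F, `|c - f t| < e%:C.
Proof.
split=> [fc e e0|h].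
  by apply: (@cvgrPdist_lt R[i] R[i]^o T F FF f c).1 fc _ _; rewrite ltcR.
apply/(@cvgrPdist_lt R[i] R[i]^o T F FF f c) => -[e e'].
by rewrite ltcE /= => /andP[/eqP -> e0]; exact: h.
Qed.

Lemma cvg_complexP f c : f @ F --> (c : R[i]^o) <->
  (complex.Re (f t) @[t --> F] --> complex.Re c) /\
  (complex.Im (f t) @[t --> F] --> complex.Im c).
Proof.
split=> [/cvgc_ltP fc|[/cvgrPdist_lt fr /cvgrPdist_lt fi]].
  split; apply/cvgrPdist_lt => e /fc; apply: filterS => t; rewrite -ltcR.
    by rewrite -cReN -cReD; exact/le_lt_trans/normc_ge_Re.
  by rewrite -cImN -cImD; exact/le_lt_trans/normc_ge_Im.
apply/cvgc_ltP => e e0; have e20 : 0 < e / 2 by rewrite divr_gt0.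
move: (fr _ e20) (fi _ e20); apply: filterS2 => t frt fit.
apply: (le_lt_trans (normc_le_ReIm _)).
by rewrite ltcR !(cReD,cImD,cReN,cImN) [e]splitr ltrD.
Qed.

Lemma cvgcM f g c d : f @ F --> (c : R[i]^o) -> g @ F --> (d : R[i]^o) ->
  f t * g t @[t --> F] --> (c * d : R[i]^o).
Proof. exact: (@cvgM R[i]). Qed.

Lemma cvgcD f g c d : f @ F --> (c : R[i]^o) -> g @ F --> (d : R[i]^o) ->
  f t + g t @[t --> F] --> (c + d : R[i]^o).
Proof. exact: (@cvgD R[i] R[i]^o). Qed.

Lemma cvgcV f c : c != 0 -> f @ F --> (c : R[i]^o) ->
  (f t)^-1 @[t --> F] --> (c^-1 : R[i]^o).
Proof. exact: (@cvgV R[i]). Qed.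

End complex_limits.

(** * Nontangential limits *)

Section nontangential_limits.
Context {R : realType}.
Implicit Types (f g : R[i] -> R[i]) (x K : R) (c d z : R[i]).

Lemma upper_neq0 z x : upper_half_plane z -> z - x%:C != 0.
Proof.
move=> zU; rewrite subr_eq0; apply/eqP => zx; move: zU.
by rewrite zx /upper_half_plane /= ltxx.
Qed.

Lemma nt_limitP f x c : nt_limit f x c <->
  forall K e : R, 0 < e -> exists2 d : R, 0 < d &
    forall z, nt_sector x K z -> `|z - x%:C| < d%:C -> `|c - f z| < e%:C.
Proof.
split=> [fc K e e0|h K].
  have /cvgc_ltP/(_ e e0) := fc K.
  rewrite /within /= => /(@nbhs_ballP R[i] R[i]^o)[[d d'] /=].
  rewrite ltcE /= => /andP[/eqP -> d0] dball.
  exists d => // z zK zx; apply: dball => //.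
  by rewrite -ball_normE /= distrC.
apply/cvgc_ltP => e /(h K)[d d0 hd].
rewrite /within /=; apply/(@nbhs_ballP R[i] R[i]^o); exists d%:C.
  by rewrite /= ltcR.
by move=> z; rewrite -ball_normE /= distrC => zx zK; exact: hd.
Qed.

Lemma eq_nt_limit f g x c : {in upper_half_plane, f =1 g} ->
  nt_limit f x c -> nt_limit g x c.
Proof.
move=> fg /nt_limitP fc; apply/nt_limitP => K e /(fc K)[d d0 hd].
exists d => // z zK zx; rewrite -fg; last by apply/mem_set; case: zK.
exact: hd.
Qed.

Lemma nt_limit_cst c x : nt_limit (fun=> c) x c.
Proof. by move=> K; exact: (@cvg_cst R[i]^o). Qed.

Lemma nt_limit_id x : nt_limit id x x%:C.
Proof.
by apply/nt_limitP => K e e0; exists e => // z _; rewrite distrC.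
Qed.

Lemma nt_limitD f g x c d : nt_limit f x c -> nt_limit g x d ->
  nt_limit (fun z => f z + g z) x (c + d).
Proof. by move=> fc gd K; exact: (cvgcD (fc K) (gd K)). Qed.

Lemma nt_limitM f g x c d : nt_limit f x c -> nt_limit g x d ->
  nt_limit (fun z => f z * g z) x (c * d).
Proof. by move=> fc gd K; exact: (cvgcM (fc K) (gd K)). Qed.

Lemma nt_limitV f x c : c != 0 -> nt_limit f x c ->
  nt_limit (fun z => (f z)^-1) x c^-1.
Proof. by move=> c0 fc K; exact: (cvgcV c0 (fc K)). Qed.

(** A difference quotient with a limit forces the numerator to vanish at the
    boundary point; a boundary value never has to be established separately from
    the derivative. *)
Lemma nt_limit_slope f x c d :
  nt_limit (fun z => (f z - c) / (z - x%:C)) x d -> nt_limit f x c.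
Proof.
move=> fd; have := nt_limitD (@nt_limit_cst c x)
  (nt_limitM fd (nt_limitD (@nt_limit_id x) (@nt_limit_cst (- x%:C) x))).
rewrite subrr mulr0 addr0; apply: eq_nt_limit => z /set_mem zU /=.
by rewrite divfK ?subrKC// upper_neq0.
Qed.

Lemma nt_limit_seq f x c K (u : nat -> R[i]) : nt_limit f x c ->
  (forall n, nt_sector x K (u n)) -> u @ \oo --> (x%:C : R[i]^o) ->
  f (u n) @[n --> \oo] --> (c : R[i]^o).
Proof.
move=> /nt_limitP fc uK /cvgc_ltP ux; apply/cvgc_ltP => e /(fc K)[d /ux + hd].
by apply: filterS => n; rewrite distrC; exact: hd.
Qed.

(** The theorems on exchanging limit and integral speak of sequences; this
    reduction makes them available for the sector filters. *)
Lemma nt_limit_seqP f x c :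
  (forall K (u : nat -> R[i]), (forall n, nt_sector x K (u n)) ->
     u @ \oo --> (x%:C : R[i]^o) ->
     f (u n) @[n --> \oo] --> (c : R[i]^o)) -> nt_limit f x c.
Proof.
move=> h; apply/nt_limitP => K e e0; apply: contrapT => hno.
have /choice[u hu] (n : nat) : exists z, [/\ nt_sector x K z,
    `|z - x%:C| < (n.+1%:R^-1)%:C & ~ `|c - f z| < e%:C].
  (* Otherwise the radius 1/(n+1) would witness the negated statement. *)
  apply: contrapT => hn; apply: hno; exists n.+1%:R^-1 => // z zK zx.
  by apply: contrapT => ?; apply: hn; exists z.
have ux : u @ \oo --> (x%:C : R[i]^o).
  apply/cvgc_ltP => d d0; have := @near_infty_natSinv_lt R (PosNum d0).
  apply: filterS => n nd; rewrite distrC; have [_ /lt_trans + _] := hu n.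
  by apply; rewrite ltcR.
have /cvgc_ltP/(_ e e0) := h K u (fun n => let: And3 k _ _ := hu n in k) ux.
by move=> [N _ /(_ N (leqnn N)) /=]; case: (hu N).
Qed.

Definition vertical x (n : nat) : R[i] := x +i* n.+1%:R^-1.

Lemma vertical_sector x n : nt_sector x 0 (vertical x n).
Proof.
by split; rewrite /upper_half_plane/= ?invr_gt0// subrr normr0 mul0r.
Qed.

Lemma cvg_vertical x : vertical x @ \oo --> (x%:C : R[i]^o).
Proof.
by apply/cvg_complexP; split; [exact: cvg_cst|exact: cvg_harmonic].
Qed.

(** The vertical approach stays in the sector of aperture [0], so that the
    sector filter of aperture [0] is nontrivial, and one such approach is enough
    to separate limits. *)
Lemma nt_limit_unique f x c d : nt_limit f x c -> nt_limit f x d -> c = d.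
Proof.
move=> fc fd; have fv e (fe : nt_limit f x e) :=
  nt_limit_seq fe (vertical_sector x) (@cvg_vertical x).
have [/cvg_complexP[rc ic] /cvg_complexP[rd id]] := (fv _ fc, fv _ fd).
apply: complex_eqP; first exact: (cvg_unique _ rc rd).
exact: (cvg_unique _ ic id).
Qed.

End nontangential_limits.

Arguments nt_limit_cst {R} c x.
Arguments nt_limit_id {R} x.
Arguments cvg_vertical {R} x.

(** * Complex-valued integrals and dominated convergence *)

Section complex_measurability.
Context {R : realType}.
Local Notation T := (measurableTypeR R).
Implicit Types (f g : T -> R[i]) (h : T -> R).

(** Measurability of both parts is what the componentwise definition of the
    complex integral needs; this class is stable under the field operations,
    which covers all rational kernels below. *)
Definition cmeasurable f : Prop :=
  measurable_fun setT (fun s => complex.Re (f s)) /\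
  measurable_fun setT (fun s => complex.Im (f s)).

Lemma cmeasurable_real h : measurable_fun setT h ->
  cmeasurable (fun s => (h s)%:C).
Proof. by move=> mh; split => //=; exact: measurable_cst. Qed.

Lemma cmeasurable_cst c : cmeasurable (fun=> c).
Proof. by split; exact: measurable_cst. Qed.

Lemma cmeasurableD f g : cmeasurable f -> cmeasurable g ->
  cmeasurable (fun s => f s + g s).
Proof.
move=> [rf jf] [rg jg]; split.
  rewrite (funext (fun s => cReD (f s) (g s))); exact: measurable_funD rf rg.
rewrite (funext (fun s => cImD (f s) (g s))); exact: measurable_funD jf jg.
Qed.

Lemma cmeasurableN f : cmeasurable f -> cmeasurable (fun s => - f s).
Proof.
move=> [rf jf]; split.
  by rewrite (funext (fun s => cReN (f s))); exact: measurableT_comp.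
by rewrite (funext (fun s => cImN (f s))); exact: measurableT_comp.
Qed.

Lemma cmeasurableM f g : cmeasurable f -> cmeasurable g ->
  cmeasurable (fun s => f s * g s).
Proof.
move=> [rf jf] [rg jg]; split.
  rewrite (funext (fun s => cReM (f s) (g s))).
  exact: measurable_funB (measurable_funM rf rg) (measurable_funM jf jg).
rewrite (funext (fun s => cImM (f s) (g s))).
exact: measurable_funD (measurable_funM rf jg) (measurable_funM jf rg).
Qed.

(** The inverse coincides with the power function of exponent [-1] on the
    nonnegative reals, including at [0], where both are [0]. *)
Lemma measurable_fun_ge0V h : measurable_fun setT h -> (forall s, 0 <= h s) ->
  measurable_fun setT (fun s => (h s)^-1).
Proof.
move=> mh h0; rewrite -(funext (fun s => powR_inv1 (h0 s))).
exact: measurableT_comp (measurable_powR (-1)) mh.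
Qed.

Lemma cmeasurableV f : cmeasurable f -> cmeasurable (fun s => (f s)^-1).
Proof.
move=> [rf jf].
have mV : measurable_fun setT
    (fun s => (complex.Re (f s) ^+ 2 + complex.Im (f s) ^+ 2)^-1).
  apply: measurable_fun_ge0V => [|s]; last by rewrite addr_ge0 ?sqr_ge0.
  exact: measurable_funD (measurable_funX 2 rf) (measurable_funX 2 jf).
split; first by rewrite (funext (fun s => cReV (f s))); exact: measurable_funM.
rewrite (funext (fun s => cImV (f s))); apply: measurableT_comp => //.
exact: measurable_funM.
Qed.

End complex_measurability.

Section complex_integrals.
Context {R : realType}.
Local Notation T := (measurableTypeR R).
Variable m : {measure set T -> \bar R}.
Implicit Types (f g : T -> R[i]) (h : T -> R).

Lemma le_cintegrable f h : cmeasurable f ->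
  m.-integrable setT (EFin \o h) -> (forall s, `|f s| <= (h s)%:C) ->
  cintegrable m f.
Proof.
move=> [rf jf] ih fh; split.
  apply: le_integrable ih => //; first exact/measurable_EFinP.
  move=> s _ /=; rewrite lee_fin -lecR.
  apply: le_trans (normc_ge_Re _) _; apply: le_trans (fh s) _.
  by rewrite lecR ler_norm.
apply: le_integrable ih => //; first exact/measurable_EFinP.
move=> s _ /=; rewrite lee_fin -lecR.
apply: le_trans (normc_ge_Im _) _; apply: le_trans (fh s) _.
by rewrite lecR ler_norm.
Qed.

Lemma cintegralD f g : cintegrable m f -> cintegrable m g ->
  cintegral m (fun s => f s + g s) = cintegral m f + cintegral m g.
Proof.
move=> [rf jf] [rg jg]; apply: complex_eqP; rewrite /= -RintegralD//;
  by apply: eq_Rintegral => s _; rewrite !(cReD, cImD).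
Qed.

(** Lets a kernel be changed on a null set: the pole of a totalized kernel, or
    the complement of an atom of full mass. *)
Lemma eq_cintegral_off f g (N : set T) : measurable N -> m N = 0%E ->
  cmeasurable f -> cmeasurable g -> (forall s, ~ N s -> f s = g s) ->
  cintegral m f = cintegral m g.
Proof.
move=> mN N0 [rf jf] [rg jg] fg.
have eq_off (u v : T -> R) : measurable_fun setT u -> measurable_fun setT v ->
    (forall s, ~ N s -> u s = v s) -> \int[m]_s u s = \int[m]_s v s.
  move=> mu mv uv; congr fine; apply: ae_eq_integral => //;
    [exact/measurable_EFinP|exact/measurable_EFinP|].
  exists N; split => // s /= h; apply: contrapT => Ns.
  by apply: h => _; rewrite uv.
by apply: complex_eqP; apply: eq_off => // s /fg ->.
Qed.

Section scaling.
Variables (c : R[i]) (f : T -> R[i]).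
Hypothesis intf : cintegrable m f.

Let integrable_scale (a : R) (u : T -> R) : m.-integrable setT (EFin \o u) ->
  m.-integrable setT (EFin \o (fun s => a * u s)).
Proof. by move=> iu; exact: (integrableZl measurableT a iu). Qed.

Lemma cintegrableZ : cintegrable m (fun s => c * f s).
Proof.
have [rf jf] := intf; split.
  rewrite (funext (fun s => congr1 EFin (cReM c (f s)))).
  exact: integrableB (integrable_scale _ rf) (integrable_scale _ jf).
rewrite (funext (fun s => congr1 EFin (cImM c (f s)))).
exact: integrableD (integrable_scale _ jf) (integrable_scale _ rf).
Qed.

Lemma cintegralZ : cintegral m (fun s => c * f s) = c * cintegral m f.
Proof.
have [rf jf] := intf.
apply: complex_eqP; rewrite /= ?(cReM, cImM) /= -!RintegralZl//.
  rewrite -RintegralB//; try exact: integrable_scale.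
  by apply: eq_Rintegral => s _; rewrite cReM.
rewrite -RintegralD//; try exact: integrable_scale.
by apply: eq_Rintegral => s _; rewrite cImM.
Qed.

End scaling.

Lemma cvg_Rintegral (u : nat -> T -> R) (v h : T -> R) :
  (forall n, measurable_fun setT (u n)) -> measurable_fun setT v ->
  (forall s, u n s @[n --> \oo] --> v s) ->
  m.-integrable setT (EFin \o h) -> (forall n s, `|u n s| <= h s) ->
  \int[m]_s u n s @[n --> \oo] --> \int[m]_s v s.
Proof.
move=> mu mv uv ih uh.
have [iv _ cv] : [/\ m.-integrable setT (EFin \o v),
    (fun n => \int[m]_s `|(u n s)%:E - (v s)%:E|) @ \oo --> 0 &
    \int[m]_s (u n s)%:E @[n --> \oo] --> \int[m]_s (v s)%:E]%E.
  apply: (@dominated_convergence _ T R m setT measurableT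
    (fun n s => (u n s)%:E) (EFin \o v) (EFin \o h)) => //.
  - by move=> n; exact/measurable_EFinP.
  - exact/measurable_EFinP.
  - by apply: aeW => s _; apply: cvg_EFin; [exact: nearW|exact: uv].
  - by apply: aeW => s n _; rewrite lee_fin.
by apply: fine_cvg; rewrite fineK// integrable_fin_num.
Qed.

(** Dominated convergence for nontangential limits: the dominating function may
    depend on the sector, since a limit is only requested sector by sector. *)
Lemma nt_limit_cintegral (k : R[i] -> T -> R[i]) (l : T -> R[i]) x :
  (forall z, cmeasurable (k z)) -> cmeasurable l ->
  (forall s, nt_limit (k ^~ s) x (l s)) ->
  (forall K, exists2 h, m.-integrable setT (EFin \o h) &
     forall z s, nt_sector x K z -> `|k z s| <= (h s)%:C) ->
  nt_limit (fun z => cintegral m (k z)) x (cintegral m l).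
Proof.
move=> mk [rl jl] kl dom; apply: nt_limit_seqP => K u uK ux.
have [h ih kh] := dom K.
have cv s : (complex.Re (k (u n) s) @[n --> \oo] --> complex.Re (l s)) /\
    (complex.Im (k (u n) s) @[n --> \oo] --> complex.Im (l s)).
  exact/cvg_complexP/(nt_limit_seq (kl s) uK ux).
apply/cvg_complexP; split.
  apply: cvg_Rintegral ih _ => //.
  - by move=> n; have [] := mk (u n).
  - by move=> s; have [] := cv s.
  - by move=> n s; rewrite -lecR (le_trans (normc_ge_Re _))// kh.
apply: cvg_Rintegral ih _ => //.
- by move=> n; have [] := mk (u n).
- by move=> s; have [] := cv s.
- by move=> n s; rewrite -lecR (le_trans (normc_ge_Im _))// kh.
Qed.

End complex_integrals.

(** * Sectors, resolvents and atoms *)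

Section sector_estimates.
Context {R : realType}.
Implicit Types (z : R[i]) (x s K : R).

Lemma upper_norm_ge z s : upper_half_plane z ->
  (complex.Im z)%:C <= `|z - s%:C|.
Proof.
move=> zU; apply: le_trans (normc_ge_Im _).
by rewrite lecR cImD cImN /= subr0 ler_norm.
Qed.

Lemma nt_sector_ge0 x K z : nt_sector x K z -> 0 <= K.
Proof.
by move=> [zU /= /(le_trans (normr_ge0 _))]; rewrite pmulr_lge0.
Qed.

(** In a sector the distance to the vertex is comparable to the height, and the
    height is at most the distance to any real point. *)
Lemma nt_sector_norm x K z s : nt_sector x K z ->
  `|z - x%:C| <= (K + 1)%:C * `|z - s%:C|.
Proof.
move=> zK; have K0 := nt_sector_ge0 zK; case: zK => zU /= zK.
apply: (@le_trans _ _ ((K + 1) * complex.Im z)%:C).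
  apply: le_trans (normc_le_ReIm _) _.
  rewrite lecR !(cReD, cReN, cImD, cImN) /= subr0 mulrDl mul1r.
  by rewrite lerD// gtr0_norm.
by rewrite rmorphM ler_pM2l ?upper_norm_ge// ltcR ltr_wpDl.
Qed.

(** Triangle inequality through [z], combined with the previous bound. *)
Lemma nt_sector_norm_real x K z s : nt_sector x K z ->
  `|(s - x)%:C| <= (K + 2)%:C * `|z - s%:C|.
Proof.
move=> zK; rewrite (_ : (s - x)%:C = (z - x%:C) - (z - s%:C)); last first.
  by rewrite rmorphB; ring.
apply: le_trans (ler_normB _ _) _.
rewrite [2]/(1 + 1)%R addrA rmorphD mulrDl mul1r lerD2r.
exact: nt_sector_norm.
Qed.

End sector_estimates.

Section atoms.
Context {R : realType}.
Local Notation T := (measurableTypeR R).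
Implicit Types (m : {finite_measure set T -> \bar R}) (x : R).

Lemma measurable_real_id : measurable_fun [set: T] (id : T -> R).
Proof. exact: measurable_id. Qed.

Lemma cmeasurable_resolvent z : cmeasurable (fun s : T => (z - s%:C)^-1).
Proof.
apply: cmeasurableV; apply: cmeasurableD; first exact: cmeasurable_cst.
exact/cmeasurableN/cmeasurable_real.
Qed.

Lemma cintegrable_resolvent m z : upper_half_plane z ->
  cintegrable m (fun s => (z - s%:C)^-1).
Proof.
move=> zU; apply: (@le_cintegrable _ _ _ (cst (complex.Im z)^-1)).
- exact: cmeasurable_resolvent.
- exact: finite_measure_integrable_cst.
move=> s; rewrite /cst normfV fmorphV lef_pV2 ?upper_norm_ge// posrE.
  by rewrite normr_gt0 upper_neq0.
by rewrite ltcR.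
Qed.

(** The integrand [(z - x) / (z - s)] equals [1] at [s = x], tends to [0] at any
    other [s], and is bounded by [K + 1] on the sector of aperture [K]. *)
Lemma nt_limit_atom m x :
  nt_limit (fun z => (z - x%:C) * cintegral m (fun s => (z - s%:C)^-1)) x
    (fine (m [set x]))%:C.
Proof.
have -> : (fine (m [set x]))%:C =
    cintegral m (fun s => (\1_[set x] s : R)%:C).
  apply: complex_eqP; rewrite /= /Rintegral.
    by rewrite integral_indic// setIT.
  by rewrite integral0.
apply: (@eq_nt_limit _ (fun z => cintegral m
    (fun s => (z - x%:C) * (z - s%:C)^-1))).
  by move=> z /set_mem zU; rewrite cintegralZ//; exact: cintegrable_resolvent.
apply: nt_limit_cintegral.
- move=> z; apply: cmeasurableM; first exact: cmeasurable_cst.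
  exact: cmeasurable_resolvent.
- by apply: cmeasurable_real; exact: measurable_indic.
- move=> s; rewrite indicE; have [sx|sx] := eqVneq s x.
    rewrite sx mem_set//; apply: eq_nt_limit (nt_limit_cst 1 x).
    by move=> z /set_mem zU; rewrite divff// upper_neq0.
  rewrite memNset//; last exact/eqP.
  have := nt_limitM (nt_limitD (nt_limit_id x) (nt_limit_cst (- x%:C) x))
    (nt_limitV _ (nt_limitD (nt_limit_id x) (nt_limit_cst (- s%:C) x))).
  rewrite subrr mul0r; apply.
  by rewrite -rmorphB fmorph_eq0 subr_eq0 eq_sym.
move=> K; exists (cst (K + 1)); first exact: finite_measure_integrable_cst.
move=> z s zK; rewrite normrM normfV ler_pdivrMr ?nt_sector_norm//.
by rewrite normr_gt0 upper_neq0//; case: zK.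
Qed.

End atoms.

Arguments nt_limit_atom {R} m x.

(** * The function f of the Nevanlinna measure *)

Section nevanlinna_weight.
Context {R : realType}.
Local Notation T := (measurableTypeR R).
Variables (rho : {finite_measure set T -> \bar R}) (x : R).
Implicit Types (s : T) (n : nat).

(** Real-valued version of the density defining [f]; the totalized division
    makes it [0] at the pole [s = x]. *)
Definition jc_weight s : R := (s ^+ 2 + 1) / (s - x) ^+ 2.

(** The density regularized at height [y = 1/(n+1)]: it is the imaginary part
    of the Nevanlinna kernel at [x + i y], divided by [y]. *)
Definition jc_weight_trunc n s : R :=
  (s ^+ 2 + 1) / ((s - x) ^+ 2 + n.+1%:R^-1 ^+ 2).

Definition jc_density s : \bar R := ((s ^+ 2 + 1)%:E / ((s - x) ^+ 2)%:E)%E.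

Lemma sqr_add1_gt0 (s : R) : 0 < s ^+ 2 + 1.
Proof. by rewrite ltr_wpDl// sqr_ge0. Qed.

Lemma jc_densityE s : s != x -> jc_density s = (jc_weight s)%:E.
Proof.
by move=> sx; rewrite /jc_density inver sqrf_eq0 subr_eq0 (negbTE sx).
Qed.

Lemma jc_density_pole : jc_density x = +oo%E.
Proof.
by rewrite /jc_density inver subrr expr0n eqxx gt0_muley// lte_fin sqr_add1_gt0.
Qed.

Lemma jc_weight_ge0 s : 0 <= jc_weight s.
Proof. by rewrite divr_ge0 ?sqr_ge0// ltW// sqr_add1_gt0. Qed.

Lemma jc_density_ge s : ((jc_weight s)%:E <= jc_density s)%E.
Proof.
have [->|sx] := eqVneq s x; first by rewrite jc_density_pole leey.
by rewrite jc_densityE.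
Qed.

Lemma jc_density_ge0 s : (0 <= jc_density s)%E.
Proof. by apply: le_trans (jc_density_ge s); rewrite lee_fin jc_weight_ge0. Qed.

Lemma jc_denominator_gt0 n s : 0 < (s - x) ^+ 2 + n.+1%:R^-1 ^+ 2.
Proof. by rewrite ltr_wpDl ?sqr_ge0// exprn_gt0// invr_gt0. Qed.

Lemma jc_weight_trunc_ge0 n s : 0 <= jc_weight_trunc n s.
Proof. by rewrite divr_ge0// ltW// ?jc_denominator_gt0// sqr_add1_gt0. Qed.

Lemma measurable_sqr_add1 :
  measurable_fun [set: T] (fun s : T => (s : R) ^+ 2 + 1).
Proof.
apply: measurable_funD; last exact: measurable_cst.
exact: measurable_funX measurable_real_id.
Qed.

Lemma measurable_sqr_sub :
  measurable_fun [set: T] (fun s : T => (s - x : R) ^+ 2).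
Proof.
apply: measurable_funX; apply: measurable_funB; last exact: measurable_cst.
exact: measurable_real_id.
Qed.

Lemma measurable_jc_weight : measurable_fun [set: T] jc_weight.
Proof.
apply: measurable_funM; first exact: measurable_sqr_add1.
apply: measurable_fun_ge0V; first exact: measurable_sqr_sub.
by move=> s; exact: sqr_ge0.
Qed.

Lemma measurable_jc_weight_trunc n :
  measurable_fun [set: T] (jc_weight_trunc n).
Proof.
apply: measurable_funM; first exact: measurable_sqr_add1.
apply: measurable_fun_ge0V; last by move=> s; rewrite ltW// jc_denominator_gt0.
exact: measurable_funD measurable_sqr_sub (measurable_cst _).
Qed.

Lemma jc_weight_trunc_nondecreasing s :
  nondecreasing_seq (fun n => jc_weight_trunc n s).
Proof.
move=> m n mn; rewrite ler_pM2l ?sqr_add1_gt0//.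
rewrite lef_pV2 ?posrE ?jc_denominator_gt0// lerD2l.
by rewrite lerXn2r ?nnegrE ?invr_ge0// lef_pV2 ?posrE// ler_nat.
Qed.

(** At the pole the regularized density blows up, in agreement with the value
    [+oo] of the extended density. *)
Lemma cvg_jc_weight_trunc s :
  ((jc_weight_trunc n s)%:E @[n --> \oo] --> jc_density s)%E.
Proof.
have [->|sx] := eqVneq s x.
  rewrite jc_density_pole; apply/cvgeryP/cvgryPge => A.
  near=> n; rewrite /jc_weight_trunc subrr expr0n add0r -exprVn invrK.
  apply: (@le_trans _ _ n.+1%:R).
    by rewrite -natr1 ler_wpDr//; near: n; exact: nbhs_infty_ger.
  rewrite -[leLHS]mul1r expr2 mulrA ler_pM2r// -[leLHS]mulr1.
  by rewrite ler_pM// ?ler1n// lerDr sqr_ge0.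
rewrite jc_densityE//; apply: cvg_EFin; first exact: nearW.
apply: cvgM; first exact: cvg_cst.
have sx0 : (s - x) ^+ 2 != 0 by rewrite sqrf_eq0 subr_eq0.
rewrite -[(s - x) ^+ 2 in X in _ --> X]addr0.
apply: cvgV; first by rewrite addr0.
apply: cvgD; first exact: cvg_cst.
rewrite -[0](mulr0 0); exact: cvgM (@cvg_harmonic R) (@cvg_harmonic R).
Unshelve. all: by end_near. Qed.

Lemma measurable_jc_density : measurable_fun [set: T] jc_density.
Proof.
apply: (emeasurable_fun_cvg (fun n s => (jc_weight_trunc n s)%:E)).
  by move=> n; apply/measurable_EFinP; exact: measurable_jc_weight_trunc.
by move=> s _; exact: cvg_jc_weight_trunc.
Qed.

(** Monotone convergence: the regularized densities increase with [n]. *)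
Lemma cvg_integral_jc_weight_trunc :
  (\int[rho]_s (jc_weight_trunc n s)%:E @[n --> \oo] -->
     nevanlinna_f rho x)%E.
Proof.
rewrite /nevanlinna_f.
rewrite (_ : (\int[rho]_s _)%E =
    (\int[rho]_s limn (fun n => (jc_weight_trunc n s)%:E))%E); last first.
  apply: eq_integral => s _; apply/esym/cvg_lim => //.
  exact: cvg_jc_weight_trunc.
apply: cvg_monotone_convergence => //.
- by move=> n; apply/measurable_EFinP; exact: measurable_jc_weight_trunc.
- by move=> n s _; rewrite lee_fin jc_weight_trunc_ge0.
- by move=> s _ m n mn; rewrite lee_fin jc_weight_trunc_nondecreasing.
Qed.

(** The regularized density is bounded because
    [s^2 <= 2 (s - x)^2 + 2 x^2]. *)
Lemma integrable_jc_weight_trunc n :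
  rho.-integrable setT (EFin \o jc_weight_trunc n).
Proof.
set y : R := n.+1%:R^-1 ^+ 2.
apply: (@le_integrable _ _ _ rho setT measurableT _
  (cst (2 + (2 * x ^+ 2 + 1) / y)%:E)).
- by apply/measurable_EFinP; exact: measurable_jc_weight_trunc.
- move=> s _ /=; rewrite lee_fin ger0_norm ?jc_weight_trunc_ge0//.
  apply: le_trans (ler_norm _); rewrite ler_pdivrMr ?jc_denominator_gt0// -/y.
  have y0 : 0 < y by rewrite exprn_gt0// invr_gt0.
  rewrite mulrDl mulrDr -[leLHS]addr0.
  have -> : (2 * x ^+ 2 + 1) / y * ((s - x) ^+ 2 + y) =
      2 * x ^+ 2 + 1 + (2 * x ^+ 2 + 1) / y * (s - x) ^+ 2.
    by field; rewrite gt_eqF.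
  have c0 : 0 <= 2 * x ^+ 2 + 1 by have := sqr_ge0 x; lra.
  have : 0 <= (2 * x ^+ 2 + 1) / y * (s - x) ^+ 2.
    by rewrite mulr_ge0 ?divr_ge0 ?sqr_ge0 ?(ltW y0).
  set p := _ / y * _ => p0; have := sqr_ge0 (s - 2 * x); nra.
- exact: finite_measure_integrable_cst.
Qed.

Hypothesis f_fin : (nevanlinna_f rho x < +oo)%E.

Lemma integrable_jc_density : rho.-integrable setT jc_density.
Proof.
apply/integrableP; split; first exact: measurable_jc_density.
by under eq_integral do rewrite gee0_abs ?jc_density_ge0//.
Qed.

(** The density is [+oo] at [x], and an integrable function is finite almost
    everywhere. *)
Lemma nevanlinna_pole_null : rho [set x] = 0%E.
Proof.
have [N [mN N0 subN]] := integrable_ae measurableT integrable_jc_density.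
apply/eqP; rewrite -measure_le0 -N0 le_measure ?inE// => _ ->.
by apply: subN => /(_ Logic.I); rewrite jc_density_pole.
Qed.

Lemma integrable_jc_weight : rho.-integrable setT (EFin \o jc_weight).
Proof.
apply: le_integrable integrable_jc_density => //.
  by apply/measurable_EFinP; exact: measurable_jc_weight.
move=> s _ /=; rewrite (gee0_abs (jc_density_ge0 s)) ger0_norm ?jc_weight_ge0//.
exact: jc_density_ge.
Qed.

Lemma nevanlinna_fE : nevanlinna_f rho x = (\int[rho]_s jc_weight s)%:E.
Proof.
rewrite fineK; last exact: integrable_fin_num integrable_jc_weight.
apply: ae_eq_integral => //; first exact: measurable_jc_density.
  by apply/measurable_EFinP; exact: measurable_jc_weight.
exists [set x]; split => //; first exact: nevanlinna_pole_null.
move=> s /= h; apply: contrapT => /eqP sx; apply: h => _.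
exact: jc_densityE.
Qed.

End nevanlinna_weight.

Arguments cvg_integral_jc_weight_trunc {R} rho x.

(** * Boundary behaviour of the Nevanlinna integral *)

Section nevanlinna_boundary.
Context {R : realType}.
Local Notation T := (measurableTypeR R).
Variables (rho : {finite_measure set T -> \bar R}) (x : R).
Implicit Types (s : T) (z : R[i]).

(** The difference quotient in [z], based at [x], of the Nevanlinna kernel; it
    vanishes at the pole [s = x]. *)
Definition kernel_quotient z s : R[i] :=
  (s ^+ 2 + 1)%:C / ((s%:C - z) * (s - x)%:C).

Lemma real_sub_upper_neq0 z s : upper_half_plane z -> s%:C - z != 0.
Proof. by move=> zU; rewrite -oppr_eq0 opprB upper_neq0. Qed.

Lemma nevanlinna_kernelB z s : upper_half_plane z -> s != x ->
  nevanlinna_kernel z s =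
  nevanlinna_kernel x%:C s + (z - x%:C) * kernel_quotient z s.
Proof.
move=> zU sx; rewrite /nevanlinna_kernel /kernel_quotient.
rewrite rmorphB rmorphD rmorphXn rmorph1 /=; field.
by rewrite -rmorphB fmorph_eq0 subr_eq0 sx; exact: real_sub_upper_neq0.
Qed.

Lemma cmeasurable_real_id : cmeasurable (fun s : T => s%:C).
Proof. exact: cmeasurable_real. Qed.

Lemma cmeasurable_kernel z : cmeasurable (nevanlinna_kernel z : T -> R[i]).
Proof.
apply: cmeasurableM.
  apply: cmeasurableD; first exact: cmeasurable_cst.
  by apply: cmeasurableM; [exact: cmeasurable_real_id|exact: cmeasurable_cst].
apply: cmeasurableV; apply: cmeasurableD; first exact: cmeasurable_real_id.
exact: cmeasurable_cst.
Qed.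

Lemma cmeasurable_kernel_quotient z : cmeasurable (kernel_quotient z).
Proof.
apply: cmeasurableM.
  by apply: cmeasurable_real; exact: measurable_sqr_add1.
apply: cmeasurableV; apply: cmeasurableM.
  apply: cmeasurableD; first exact: cmeasurable_real_id.
  exact: cmeasurable_cst.
apply: cmeasurable_real.
apply: measurable_funB; first exact: measurable_real_id.
exact: measurable_cst.
Qed.

(** Sector bound [|s - x| <= (K + 2) |s - z|]: replacing [s - z] by [s - x] in
    the denominator costs only a constant. *)
Lemma kernel_quotient_le K z s : nt_sector x K z ->
  `|kernel_quotient z s| <= ((K + 2) * jc_weight x s)%:C.
Proof.
move=> zK; have zU := zK.1; rewrite /kernel_quotient /jc_weight.
have [->|sx] := eqVneq s x.
  by rewrite subrr mulr0 invr0 mulr0 normr0 expr0n invr0 !mulr0.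
have sx0 : 0 < `|s - x| by rewrite normr_gt0 subr_eq0.
have sz0 : 0 < `|s%:C - z| by rewrite normr_gt0 real_sub_upper_neq0.
rewrite normrM normfV normrM !normc_real (gtr0_norm (sqr_add1_gt0 _)).
rewrite ler_pdivrMr; last by rewrite mulr_gt0// ltcR.
rewrite (_ : ((K + 2) * ((s ^+ 2 + 1) / (s - x) ^+ 2))%:C *
    (`|s%:C - z| * `|s - x|%:C) =
    (s ^+ 2 + 1)%:C * (`|s - x|^-1%:C * ((K + 2)%:C * `|s%:C - z|)));
    last first.
  transitivity (((K + 2) * ((s ^+ 2 + 1) / (s - x) ^+ 2) * `|s - x|)%:C *
      `|s%:C - z|); first by rewrite [in RHS]rmorphM /=; ring.
  rewrite -[(s - x) ^+ 2]real_normK ?num_real//.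
  have -> : (K + 2) * ((s ^+ 2 + 1) / `|s - x| ^+ 2) * `|s - x| =
      (s ^+ 2 + 1) * (`|s - x|^-1 * (K + 2)) by field; rewrite gt_eqF.
  by rewrite 2!rmorphM /=; ring.
rewrite -[leLHS]mulr1 ler_pM2l ?ltcR ?sqr_add1_gt0//.
rewrite fmorphV mulrC ler_pdivlMr ?ltcR// mul1r [`|s%:C - z|]distrC.
by have := nt_sector_norm_real s zK; rewrite normc_real.
Qed.

Hypothesis f_fin : (nevanlinna_f rho x < +oo)%E.

Lemma integrable_jc_weightZ (c : R) :
  rho.-integrable setT (EFin \o (fun s => c * jc_weight x s)).
Proof. exact: (integrableZl measurableT c (integrable_jc_weight f_fin)). Qed.

Lemma cintegrable_kernel_quotient z : upper_half_plane z ->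
  cintegrable rho (kernel_quotient z).
Proof.
move=> zU; pose K := `|complex.Re z - x| / complex.Im z.
(* Every point of the upper half-plane lies in some sector at [x]. *)
have zK : nt_sector x K z by split => //=; rewrite divfK// gt_eqF.
apply: (le_cintegrable (cmeasurable_kernel_quotient z)).
  exact: (integrable_jc_weightZ (K + 2)).
by move=> s; exact: kernel_quotient_le zK.
Qed.

(** From [(1 + s x)^2 + (s - x)^2 = (1 + s^2) (1 + x^2)] the product
    [|1 + s x| |s - x|] is at most the right-hand side, so the kernel is
    dominated by a multiple of the weight. *)
Lemma cintegrable_kernel_real : cintegrable rho (nevanlinna_kernel x%:C).
Proof.
apply: (le_cintegrable (cmeasurable_kernel _)).
  exact: (integrable_jc_weightZ (x ^+ 2 + 1)).
move=> s; rewrite /nevanlinna_kernel /jc_weight.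
rewrite -rmorphM -rmorphB -fmorphV -(rmorph1 (real_complex R)).
rewrite -rmorphD -rmorphM.
rewrite normc_real lecR.
have [->|sx] := eqVneq s x.
  by rewrite subrr expr0n invr0 !mulr0 normr0.
rewrite normrM normfV ler_pdivrMr ?normr_gt0 ?subr_eq0//.
rewrite -[(s - x) ^+ 2]real_normK ?num_real//.
have sx0 : 0 < `|s - x| by rewrite normr_gt0 subr_eq0.
have -> : (x ^+ 2 + 1) * ((s ^+ 2 + 1) / `|s - x| ^+ 2) * `|s - x| =
    (x ^+ 2 + 1) * (s ^+ 2 + 1) / `|s - x| by field; rewrite gt_eqF.
rewrite ler_pdivlMr// -normrM ler_norml.
have -> : (x ^+ 2 + 1) * (s ^+ 2 + 1) = (1 + s * x) ^+ 2 + (s - x) ^+ 2.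
  by ring.
move: (1 + s * x) (s - x) => a b.
have := (sqr_ge0 (a - b), sqr_ge0 (a + b), sqr_ge0 a, sqr_ge0 b).
by move=> [[[? ?] ?] ?]; apply/andP; split; nra.
Qed.

Lemma cintegral_kernelE z : upper_half_plane z ->
  cintegral rho (nevanlinna_kernel z) =
  cintegral rho (nevanlinna_kernel x%:C) +
  (z - x%:C) * cintegral rho (kernel_quotient z).
Proof.
move=> zU; have iq := cintegrable_kernel_quotient zU.
rewrite -(cintegralZ _ iq) -cintegralD; last 2 first.
- exact: cintegrable_kernel_real.
- exact: cintegrableZ.
apply: (eq_cintegral_off (measurable_set1 x) (nevanlinna_pole_null f_fin)).
- exact: cmeasurable_kernel.
- apply: cmeasurableD; first exact: cmeasurable_kernel.
  apply: cmeasurableM; first exact: cmeasurable_cst.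
  exact: cmeasurable_kernel_quotient.
- by move=> s /eqP; exact: nevanlinna_kernelB.
Qed.

Lemma nt_limit_kernel_quotient :
  nt_limit (fun z => cintegral rho (kernel_quotient z)) x
    (\int[rho]_s jc_weight x s)%:C.
Proof.
have -> : (\int[rho]_s jc_weight x s)%:C =
    cintegral rho (fun s => (jc_weight x s)%:C).
  by apply: complex_eqP => //=; rewrite /Rintegral integral0.
apply: nt_limit_cintegral.
- exact: cmeasurable_kernel_quotient.
- by apply: cmeasurable_real; exact: measurable_jc_weight.
- move=> s; rewrite /kernel_quotient /jc_weight; have [->|sx] := eqVneq s x.
    rewrite subrr expr0n invr0 mulr0; apply: eq_nt_limit (nt_limit_cst _ x).
    by move=> z _; rewrite mulr0 invr0 mulr0.
  rewrite rmorphM fmorphV /= expr2 rmorphM.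
  have sx0 : (s - x)%:C != 0 :> R[i] by rewrite fmorph_eq0 subr_eq0.
  apply: nt_limitM; first exact: nt_limit_cst.
  apply: nt_limitV; first by rewrite mulf_neq0.
  apply: nt_limitM; last exact: nt_limit_cst.
  rewrite rmorphB; apply: nt_limitD; first exact: nt_limit_cst.
  have := nt_limitM (nt_limit_cst (-1) x) (nt_limit_id x); rewrite mulN1r.
  by apply: eq_nt_limit => z _; rewrite mulN1r.
move=> K; exists (fun s => (K + 2) * jc_weight x s).
  exact: integrable_jc_weightZ.
by move=> z s; exact: kernel_quotient_le.
Qed.

End nevanlinna_boundary.

(** * The Julia-Caratheodory derivative and f *)

Section boundary_values.
Context {R : realType}.
Local Notation T := (measurableTypeR R).
Variables (mu : probability T R) (rho : {finite_measure set T -> \bar R}).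
Hypothesis mu_rho : nevanlinna_measure mu rho.
Variable x : R.

Section finite_f.
Hypothesis f_fin : (nevanlinna_f rho x < +oo)%E.

Lemma nt_slope_nevanlinna :
  nt_limit (fun z => (F_transform mu z - nevanlinna_formula mu rho x%:C) /
    (z - x%:C)) x (1 + \int[rho]_s jc_weight x s)%:C.
Proof.
have := nt_limitD (nt_limit_cst 1 x) (nt_limit_kernel_quotient f_fin).
rewrite -(rmorph1 (real_complex R)) -rmorphD.
apply: eq_nt_limit => z /set_mem zU; rewrite mu_rho// /nevanlinna_formula.
rewrite (cintegral_kernelE f_fin zU) rmorph1; field.
exact: upper_neq0.
Qed.

Lemma nevanlinna_at_finite : nevanlinna_at mu rho x.
Proof.
split; first exact: nevanlinna_pole_null.
  exact: cintegrable_kernel_real.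
exact: nt_limit_slope nt_slope_nevanlinna.
Qed.

Lemma JC_derivative_finite :
  JC_derivative (F_transform mu) x (1 + \int[rho]_s jc_weight x s)%:C.
Proof.
exists (nevanlinna_formula mu rho x%:C); last exact: nt_slope_nevanlinna.
exact: nt_limit_slope nt_slope_nevanlinna.
Qed.

End finite_f.

Lemma Im_kernel_vertical n (s : R) :
  complex.Im (nevanlinna_kernel (vertical x n) s) =
  n.+1%:R^-1 * jc_weight_trunc x n s.
Proof.
have := jc_denominator_gt0 x n s; rewrite /jc_weight_trunc /nevanlinna_kernel.
rewrite cImM cReV cImV /vertical /=; set y := n.+1%:R^-1 => d0.
rewrite !(mul0r, sub0r, add0r, addr0, subr0, mulr0, mul1r) sqrrN.
by field; rewrite gt_eqF.
Qed.

(** Since [c] is real, dividing by [i y] turns the imaginary part of [F] into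
    the real part of the quotient; the unknown real part of [F] drops out. *)
Lemma Re_slope_vertical (c : R) n :
  complex.Re ((F_transform mu (vertical x n) - c%:C) / (vertical x n - x%:C)) =
  1 + \int[rho]_s jc_weight_trunc x n s.
Proof.
rewrite cReM cReV cImV mu_rho; last by have [] := vertical_sector x n.
have -> : complex.Im (nevanlinna_formula mu rho (vertical x n) - c%:C) =
    n.+1%:R^-1 * (1 + \int[rho]_s jc_weight_trunc x n s).
  rewrite !(cImD, cImN) /= oppr0 add0r addr0 mulrDr mulr1; congr +%R.
  rewrite -RintegralZl//; last exact: integrable_jc_weight_trunc.
  by apply: eq_Rintegral => s _; exact: Im_kernel_vertical.
move: (complex.Re _) => r; rewrite !(cReD, cReN, cImD, cImN) /= subrr subr0.
by rewrite expr0n add0r; field; rewrite nat1r pnatr_eq0.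
Qed.

(** The converse half of the Julia-Caratheodory theorem.  Finiteness of [f] is
    a conclusion: it comes from the convergence of the regularized integrals. *)
Lemma nevanlinna_f_JC (c d : R) :
  nt_limit (fun z => (F_transform mu z - c%:C) / (z - x%:C)) x d%:C ->
  nevanlinna_f rho x = (d - 1)%:E.
Proof.
move=> /nt_limit_seq/(_ (vertical_sector x) (cvg_vertical x)).
move=> /cvg_complexP[+ _]; rewrite (funext (Re_slope_vertical c)) /= => cd.
have cd1 : ((\int[rho]_s (jc_weight_trunc x n s)%:E) @[n --> \oo] -->
    (d - 1)%:E)%E.
  have -> : (fun n => \int[rho]_s (jc_weight_trunc x n s)%:E)%E =
      (fun n => (1 + \int[rho]_s jc_weight_trunc x n s - 1)%:E).
    apply/funext => n; rewrite addrAC subrr add0r fineK//.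
    exact: integrable_fin_num (integrable_jc_weight_trunc _ _ _).
  apply: cvg_EFin; first exact: nearW.
  by apply: cvgB => //; exact: cvg_cst.
exact: (cvg_unique _ (cvg_integral_jc_weight_trunc rho x) cd1).
Qed.

End boundary_values.

(** * Atoms of Boolean powers *)

Section boolean_powers.
Context {R : realType}.
Local Notation T := (measurableTypeR R).
Implicit Types (mu nu : probability T R).

(** [F_nu(z) / (z - x)] is the inverse of [(z - x) G_nu(z)], whose limit is the
    mass at [x]; both are inverted at a nonzero limit. *)
Lemma nt_slope_F_atom nu (x t : R) : 0 < t ->
  nt_limit (fun z => F_transform nu z / (z - x%:C)) x t%:C <->
  nu [set x] = t^-1%:E.
Proof.
move=> t0; have t_neq0 : t%:C != 0 :> R[i] by rewrite fmorph_eq0 gt_eqF.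
have atom : nt_limit (fun z => (z - x%:C) * cauchy_transform nu z) x
    (fine (nu [set x]))%:C by exact: nt_limit_atom.
split=> [ht|nut].
  have /(nt_limit_unique atom) : nt_limit (fun z => (z - x%:C) *
      cauchy_transform nu z) x (t^-1)%:C.
    rewrite fmorphV; apply: eq_nt_limit (nt_limitV t_neq0 ht) => z _.
    by rewrite invfM /F_transform !invrK mulrC.
  by move=> /complexI <-; rewrite fineK// fin_num_measure.
move: atom; rewrite nut /= => /nt_limitV; rewrite fmorphV invrK.
move=> /(_ (invr_neq0 t_neq0)); apply: eq_nt_limit => z _.
by rewrite invfM mulrC.
Qed.

Lemma F_transform_full_atom nu (a : R) z : nu [set a] = 1%E ->
  F_transform nu z = z - a%:C.
Proof.
move=> nua; rewrite /F_transform /cauchy_transform.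
have ma := measurable_set1 a.
have na : nu (~` [set a]) = 0%E.
  by rewrite probability_setC// nua subee.
rewrite -[RHS]invrK; congr (_^-1).
transitivity (cintegral nu (fun=> (z - a%:C)^-1)).
  apply: (@eq_cintegral_off _ nu _ _ (~` [set a])) => //.
  - exact: measurableC.
  - exact: cmeasurable_resolvent.
  - by move=> s /contrapT ->.
have int_cst (r : R) : \int[nu]_s r = r.
  rewrite Rintegral_cst//.
  exact: etrans (congr1 (fun u => r * fine u) (probability_setT nu)) (mulr1 r).
by apply: complex_eqP; exact: int_cst.
Qed.

Lemma point_mass_full_atom mu (a : R) : mu [set a] = 1%E -> point_mass mu.
Proof.
move=> mua; exists a => A mA; have ma := measurable_set1 a.
rewrite diracE; have [aA|aA] := boolP (a \in A).
  apply/eqP; rewrite eq_le probability_le1//= -mua le_measure ?inE//.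
  by move=> _ ->; exact: set_mem.
apply/eqP; rewrite -measure_le0 -(subee (x := 1%E))// -[X in (_ - X)%E]mua.
rewrite -probability_setC// le_measure ?inE//; first exact: measurableC.
by move=> s As /= sa; move: aA; rewrite -sa mem_set.
Qed.

(** The constant [x (1 - 1/q)] is the one for which the affine relation between
    [F_mu] and [F_nu] carries the value [0] of [F_nu] at [x] to a boundary value
    of [F_mu]. *)
Lemma boolean_power_slope mu nu (q x : R) z : 0 < q -> boolean_power mu q nu ->
  upper_half_plane z ->
  (F_transform mu z - (x * (1 - q^-1))%:C) / (z - x%:C) =
  q^-1%:C * (F_transform nu z / (z - x%:C)) + (1 - q^-1)%:C.
Proof.
move=> q0 /(_ z) + zU => /(_ zU); rewrite /E_transform => h.
have qC : q%:C != 0 :> R[i] by rewrite fmorph_eq0 gt_eqF.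
have -> : F_transform nu z = z - q%:C * (z - F_transform mu z).
  by rewrite -h opprB addrCA subrr addr0.
rewrite rmorphM rmorphB rmorph1 fmorphV; field.
by rewrite qC; exact: upper_neq0.
Qed.

(** For [q = 1] the conjugate exponent is [+oo], whose inverse is [0]; the
    identity [1/q + 1/q* = 1] treats all [q > 0] alike. *)
Lemma fine_div_hoelder_conjugate (q x : R) : 0 < q ->
  fine (x%:E / hoelder_conjugate q%:E)%E = x * (1 - q^-1).
Proof.
move=> q0; have q_neq0 : q != 0 by rewrite gt_eqF.
have := @hoelder_conjugate_eq1 R q%:E (ltNyr q); rewrite eqe => /(_ q_neq0).
rewrite inver (negbTE q_neq0) => h.
have -> : ((hoelder_conjugate q%:E)^-1 = (1 - q^-1)%:E)%E.
  by rewrite EFinB -h addeAC subee// add0e.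
by [].
Qed.

End boolean_powers.

Section boolean_power_atoms.
Context {R : realType}.
Local Notation T := (measurableTypeR R).
Variables (mu nu : probability T R) (q x : R).
Hypotheses (q0 : 0 < q) (nu_mu : boolean_power mu q nu).

(** The slope [t] of [F_nu] at value [0] and the slope [1 + (t - 1) / q] of
    [F_mu] at value [x (1 - 1/q)] correspond under an invertible affine map. *)
Lemma boolean_power_atomP (t : R) : 0 < t ->
  nu [set x] = t^-1%:E <->
  nt_limit (fun z => (F_transform mu z - (x * (1 - q^-1))%:C) / (z - x%:C)) x
    (1 + (t - 1) / q)%:C.
Proof.
move=> t0; have qC : q%:C != 0 :> R[i] by rewrite fmorph_eq0 gt_eqF.
rewrite -(nt_slope_F_atom nu x t0); split=> [ht|hd].
  have := nt_limitD (nt_limitM (nt_limit_cst q^-1%:C x) ht)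
    (nt_limit_cst (1 - q^-1)%:C x).
  rewrite -rmorphM -rmorphD (_ : q^-1 * t + (1 - q^-1) = 1 + (t - 1) / q).
    apply: eq_nt_limit => z /set_mem zU.
    by rewrite (boolean_power_slope _ q0 nu_mu zU).
  by field; rewrite gt_eqF.
have := nt_limitM (nt_limit_cst q%:C x)
  (nt_limitD hd (nt_limit_cst (- (1 - q^-1))%:C x)).
rewrite -rmorphD -rmorphM.
rewrite (_ : q * (1 + (t - 1) / q + - (1 - q^-1)) = t).
  apply: eq_nt_limit => z /set_mem zU.
  rewrite (boolean_power_slope _ q0 nu_mu zU) rmorphN addrK mulrA -rmorphM.
  by rewrite mulfV ?gt_eqF// rmorph1 mul1r.
by field; rewrite gt_eqF.
Qed.

(** An atom of mass [1] gives [F_nu(z) = z - x], hence [F_mu(z) = z - x / q],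
    which exhibits an atom of mass [1] of [mu] at [x / q]. *)
Lemma boolean_power_atom_lt1 : ~ point_mass mu -> (nu [set x] < 1)%E.
Proof.
move=> mu_np; rewrite lt_neqAle probability_le1 ?andbT//.
apply/eqP => nu1; apply: mu_np; apply: (@point_mass_full_atom _ _ (x / q)).
rewrite -[1%E]/(1%:E) -[1 in RHS]invr1.
apply/(nt_slope_F_atom mu (x / q) ltr01).
apply: eq_nt_limit (nt_limit_cst _ _) => z /set_mem zU.
have := nu_mu zU; rewrite /E_transform (F_transform_full_atom z nu1) => h.
have qC : q%:C != 0 :> R[i] by rewrite fmorph_eq0 gt_eqF.
have -> : F_transform mu z = z - (x / q)%:C.
  rewrite rmorphM fmorphV /= (_ : x%:C = q%:C * (z - F_transform mu z)).
    by field.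
  by rewrite -h opprB addrCA subrr addr0.
by rewrite divff// upper_neq0.
Qed.

End boolean_power_atoms.

Theorem proposition5p3 (R : realType)
    (mu : probability (measurableTypeR R) R)
    (rho : {finite_measure set (measurableTypeR R) -> \bar R})
    (q alpha : R)
    (nu : probability (measurableTypeR R) R) :
  ~ point_mass mu ->
  nevanlinna_measure mu rho ->
  0 < q ->
  boolean_power mu q nu ->
  let alpha_over_qstar : R := fine (alpha%:E / hoelder_conjugate q%:E)%E in
  let S1 : Prop := (0 < nu [set alpha])%E in
  let S2 : Prop :=
    nt_limit (F_transform mu) alpha alpha_over_qstar%:C /\
    exists2 d : R, 1 < d & JC_derivative (F_transform mu) alpha d%:C in
  let S3 : Prop :=
    nt_limit (F_transform mu) alpha alpha_over_qstar%:C /\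
    (0 < nevanlinna_f rho alpha < +oo)%E in
  [/\ S1 <-> S2,
      S1 <-> S3 &
      S1 ->
      let r := (1 - fine (nu [set alpha]))^-1 in
      [/\ 1 < r,
          nevanlinna_at mu rho alpha,
          JC_derivative (F_transform mu) alpha (1 + (q * (r - 1))^-1)%:C &
          (1 + nevanlinna_f rho alpha = (1 + (q * (r - 1))^-1)%:E)%E]].
Proof.
move=> mu_np mu_rho q0 nu_mu /=; set c := fine _.
have cE : c = alpha * (1 - q^-1) by exact: fine_div_hoelder_conjugate.
have atomP t (t0 : 0 < t) := boolean_power_atomP alpha q0 nu_mu t0.
rewrite -cE in atomP.
have nu_fin : nu [set alpha] = (fine (nu [set alpha]))%:E.
  by rewrite fineK// fin_num_measure.
set p := fine (nu [set alpha]) in nu_fin *.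
have p_lt1 : p < 1.
  have := boolean_power_atom_lt1 alpha q0 nu_mu mu_np.
  by rewrite nu_fin lte_fin.
have S1_slope : (0 < nu [set alpha])%E ->
    0 < (p^-1 - 1) / q /\
    nt_limit (fun z => (F_transform mu z - c%:C) / (z - alpha%:C)) alpha
      (1 + (p^-1 - 1) / q)%:C.
  rewrite nu_fin lte_fin => p0; split.
    by rewrite divr_gt0// subr_gt0 invf_gt1.
  by apply/atomP; rewrite ?invr_gt0// nu_fin invrK.
have S2_S1 d : 1 < d -> nt_limit (F_transform mu) alpha c%:C ->
    JC_derivative (F_transform mu) alpha d%:C -> (0 < nu [set alpha])%E.
  move=> d1 Fc [c' Fc' Fd]; rewrite (nt_limit_unique Fc' Fc) in Fd.
  (* The slope of F_nu at alpha that corresponds to the slope d of F_mu. *)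
  pose t := 1 + q * (d - 1).
  have t0 : 0 < t by rewrite addr_gt0// mulr_gt0// subr_gt0.
  have tE : d = 1 + (t - 1) / q by rewrite /t; field; rewrite gt_eqF.
  rewrite tE in Fd; have /atomP -> := Fd => //.
  by rewrite lte_fin invr_gt0.
have S1_f : (0 < nu [set alpha])%E ->
    nevanlinna_f rho alpha = ((p^-1 - 1) / q)%:E.
  move=> /S1_slope[_ /(nevanlinna_f_JC mu_rho) ->].
  by rewrite addrAC subrr add0r.
split.
- split=> [S1|[Fc [d d1 Fd]]]; last exact: S2_S1 d1 Fc Fd.
  have [d0 Fd] := S1_slope S1; have Fc := nt_limit_slope Fd.
  split; first exact: Fc.
  exists (1 + (p^-1 - 1) / q); first by rewrite ltrDl.
  exists c%:C; [exact: Fc|exact: Fd].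
- split=> [S1|[Fc /andP[f0 foo]]].
    have [d0 Fd] := S1_slope S1; split; first exact: nt_limit_slope Fd.
    by rewrite S1_f// lte_fin d0 ltry.
  apply: S2_S1 Fc (JC_derivative_finite mu_rho foo).
  by rewrite ltrDl -lte_fin -nevanlinna_fE.
- move=> S1; have [d0 Fd] := S1_slope S1.
  have p0 : 0 < p by move: S1; rewrite nu_fin.
  have -> : (q * ((1 - p)^-1 - 1))^-1 = (p^-1 - 1) / q.
    by field; rewrite !gt_eqF ?subr_gt0.
  split.
  + by rewrite invf_gt1 ?subr_gt0// ltrBlDr ltrDl.
  + by apply: nevanlinna_at_finite => //; rewrite S1_f// ltry.
  + exists c%:C; [exact: nt_limit_slope Fd|exact: Fd].
  + by rewrite S1_f.
Qed.
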